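(* Let $n\geq 2$ be an integer. Then: (i) if $n\equiv 0 \pmod 3$, then $\Delta_\ell(n)\geq 0$ for all but finitely many positive integers $\ell$; (ii) if $n\equiv 1\pmod 3$, then $\Delta_\ell(n)<0$ for all but finitely many positive integers $\ell$; (iii) if $n\equiv 2\pmod 3$ and $n<20$, then $\Delta_\ell(n)\geq 0$ for all but finitely many positive integers $\ell$; if $n\equiv 2\pmod 3$ and $n\geq 20$, then $\Delta_\ell(n)<0$ for all but finitely many positive integers $\ell$.
   Context: For integers $n\geq 0$ let $S_n$ be the symmetric group on $n$ elements ($S_0$ trivial). For an integer $\ell\geq 1$ let $C_{\ell,n}=\{(\pi_1,\dots,\pi_\ell)\in S_n^\ell : \pi_j\pi_k=\pi_k\pi_j \text{ for all } 1\le j,k\le \ell\}$ and $N_\ell(n)=|C_{\ell,n}|/|S_n|$ (so $N_\ell(0)=1$). Define $\Delta_\ell(n)=N_\ell(n)^2-N_\ell(n-1)N_\ell(n+1)$ for $n\geq 1$. The sequence is called log-concave at $n$ for $\ell$ if $\Delta_\ell(n)\ge 0$, and strictly log-convex at $n$ for $\ell$ if $\Delta_\ell(n)<0$. *)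

(* Defs.v *)
From mathcomp Require Import all_boot all_order all_algebra all_fingroup.
Set Implicit Arguments. Unset Strict Implicit. Unset Printing Implicit Defensive.
Import Order.TTheory GRing.Theory Num.Theory.

Definition commuting_tuples (l n : nat) : {set {ffun 'I_l -> {perm 'I_n}}} :=
  [set f : {ffun 'I_l -> {perm 'I_n}} | [forall j : 'I_l, forall k : 'I_l, (f j * f k == f k * f j)%g]].

Definition Nl (l n : nat) : rat :=
  (#|commuting_tuples l n|%:R / #|{perm 'I_n}|%:R)%R.

Definition Delta (l n : nat) : rat :=
  (Nl l n ^+ 2 - Nl l n.-1 * Nl l n.+1)%R.

(* Main.v *)
Require Import Defs.
From mathcomp Require Import all_boot all_order all_algebra all_fingroup.
From mathcomp Require Import ring lra zify realalg.
Set Implicit Arguments. Unset Strict Implicit. Unset Printing Implicit Defensive.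
Import Order.TTheory GRing.Theory Num.Theory.

(** Splitting off the orbit of a point gives
    [n N_l(n) = \sum_k s_l(k) N_l(n - k)], where [(k - 1)! s_l(k)] counts the
    transitive commuting [l]-tuples on [k] points.  A transitive abelian group is
    regular, so [s_l(k) = O(k^l)], with leading terms [2^l], [3^l / 2] and
    [2/3 4^l] for [k = 2, 3, 4].  Let [b] be the cube root of 3, [q = 2 / b^2 < 1] and
    [X = q^l].  After division by [b^(kl)] these three terms become [X], [1/2] and
    [2/3 X^2], whereas everything else is [O(r^l)] with [r = 5 / b^5] and
    [q^6 <= r < q^5].  Hence [N_l(n) / b^(nl)] is, up to [O(r^l)], the coefficient
    of [z^n] in [exp(z^3/6 + X z^2/2 + X^2 z^4/6)], and the sign of [Delta] for
    large [l] is that of the lowest order term in [X]: of order 0 and positive if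
    [n = 3m], of order 1 and negative if [n = 3m + 1], of order 2 with the sign of
    [6 - m] if [n = 3m + 2].  For [n = 20] that term vanishes and the term of
    order 5, still larger than the error, is negative. *)

(** * Splitting off the orbit of a point *)

Lemma mulgACA (gT : finGroupType) (a b c d : gT) :
  commute b c -> (a * b * (c * d) = a * c * (b * d))%g.
Proof. by move=> cbc; rewrite mulgA -(mulgA a) cbc !mulgA. Qed.

Section CommutingTuples.
Local Open Scope group_scope.
Variables (T : finType) (l : nat).
Implicit Types (f g h : {ffun 'I_l -> {perm T}}) (S O Z : {set T}) (x y : T).

Definition commuting f := [forall j, forall k, f j * f k == f k * f j].
Definition supported S f := [forall j, perm_on S (f j)].
Definition tuple_group f : {group {perm T}} := <<[set f j | j : 'I_l]>>%G.
Definition orb f x : {set T} := orbit 'P (tuple_group f) x.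

(** Supports inside a fixed type [T] let the recursion pass from [S] to [S :\: O] without changing
    the type of the permutations. *)
Definition commuting_on S := [set f | commuting f & supported S f].
Definition transitive_on x O := [set f in commuting_on O | orb f x == O].

Lemma commutingP f : reflect (forall j k, commute (f j) (f k)) (commuting f).
Proof.
apply: (iffP forallP) => [H j k|H j]; first by move/forallP: (H j) => /(_ k)/eqP.
by apply/forallP=> k; apply/eqP; apply: H.
Qed.

Lemma mem_tuple_group f j : f j \in tuple_group f.
Proof. by rewrite mem_gen // imset_f. Qed.

Lemma mem_orb f x : x \in orb f x.
Proof. exact: orbit_refl. Qed.

Lemma orb_stable f x j y : y \in orb f x -> f j y \in orb f x.
Proof.
case/orbitP=> p Gp <-; apply/orbitP; exists (p * f j).
  by rewrite groupM ?mem_tuple_group.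
by rewrite /= /aperm permM.
Qed.

Lemma orb_min f x Z :
  x \in Z -> (forall j y, y \in Z -> f j y \in Z) -> orb f x \subset Z.
Proof.
move=> Zx stZ; rewrite acts_sub_orbit // gen_subG.
apply/subsetP=> _ /imsetP[j _ ->]; rewrite !inE.
by apply/subsetP=> y Zy; rewrite inE; apply: stZ.
Qed.

(** Both orbits stay inside [Z], where the tuples agree. This serves to show that restricting a
    tuple to an orbit keeps that orbit. *)
Lemma eq_orb f g x Z :
    x \in Z -> (forall j y, y \in Z -> f j y \in Z) ->
    (forall j y, y \in Z -> f j y = g j y) -> orb f x = orb g x.
Proof.
move=> Zx stZ fg.
have stZg j y : y \in Z -> g j y \in Z by move=> Zy; rewrite -fg ?stZ.
apply/eqP; rewrite eqEsubset; apply/andP; split.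
  apply: orb_min (mem_orb _ _) _ => j y gy.
  by rewrite fg ?orb_stable // (subsetP (orb_min Zx stZg)).
apply: orb_min (mem_orb _ _) _ => j y fy.
by rewrite -fg ?orb_stable // (subsetP (orb_min Zx stZ)).
Qed.

Definition tuple_mul f g : {ffun 'I_l -> {perm T}} := [ffun j => f j * g j].

Lemma commuting_onP S f :
  reflect ((forall j k, commute (f j) (f k)) /\ (forall j, perm_on S (f j)))
          (f \in commuting_on S).
Proof.
rewrite inE; apply: (iffP andP) => -[/commutingP cf /forallP sf];
  by split=> //; apply/commutingP.
Qed.

Lemma transitive_onP x O f :
  reflect (f \in commuting_on O /\ orb f x = O) (f \in transitive_on x O).
Proof.
apply: (iffP setIdP) => -[? ?]; split=> //; exact/eqP.
Qed.

Lemma perm_on_sub S S' (p : {perm T}) : S \subset S' -> perm_on S p -> perm_on S' p.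
Proof. by move=> sSS' /subset_trans; apply. Qed.

(** A tuple with orbit [O] is uniquely the product of its restriction to [O] and a tuple on
    [S :\: O]. Disjoint supports commute, so the two factors can be chosen independently. *)
Lemma card_commuting_on_orb S x O : x \in O -> O \subset S ->
  #|[set f in commuting_on S | orb f x == O]| = (#|transitive_on x O| * #|commuting_on (S :\: O)|)%N.
Proof.
move=> Ox sOS; rewrite -cardsX.
pose m (u : _ * _) := tuple_mul u.1 u.2.
have disj : [disjoint O & S :\: O].
  by rewrite -setI_eq0 setIDA setIC -setIDA setDv setI0.
have gO g h j y : g \in commuting_on O -> h \in commuting_on (S :\: O) -> y \in O ->
    (g j * h j) y = g j y.
  move=> /commuting_onP[_ sg] /commuting_onP[_ sh] Oy; rewrite permM (out_perm (sh j)) //.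
  by rewrite inE (perm_closed _ (sg j)) Oy.
have com g h j k : g \in commuting_on O -> h \in commuting_on (S :\: O) ->
    commute (g j) (h k).
  by move=> /commuting_onP[_ sg] /commuting_onP[_ sh]; apply: perm_onC (sg j) (sh k) _.
rewrite -(card_in_imset (f := m)); last first.
  move=> [g h] [g' h'] /setXP[/= /transitive_onP[Hg _] Hh].
  move=> /setXP[/= /transitive_onP[Hg' _] Hh'] /ffunP E.
  have eg : g = g'.
    apply/ffunP=> j; apply/permP=> y; have := E j; rewrite !ffunE /= => Ej.
    case Oy: (y \in O).
      by rewrite -(gO g h) // Ej (gO g').
    have [[_ sg] [_ sg']] := (commuting_onP _ _ Hg, commuting_onP _ _ Hg').
    by rewrite (out_perm (sg j)) ?Oy // (out_perm (sg' j)) ?Oy.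
  congr pair => //; apply/ffunP=> j; have := E j; rewrite !ffunE /= eg.
  exact: mulgI.
apply: eq_card => f; apply/idP/imsetP.
  case/setIdP=> /commuting_onP[cf sf] /eqP Of.
  have nO j : f j \in 'N(O | 'P).
    rewrite !inE; apply/subsetP=> y Oy; rewrite inE -Of; apply: orb_stable.
    by rewrite Of.
  pose g : {ffun 'I_l -> {perm T}} := [ffun j => restr_perm O (f j)].
  (* Dividing [f j] by its restriction to [O] leaves the part that lives off [O]. *)
  pose h : {ffun 'I_l -> {perm T}} := [ffun j => (g j)^-1 * f j].
  have gE j y : y \in O -> g j y = f j y by move=> Oy; rewrite ffunE restr_permE.
  have cg : g \in commuting_on O.
    apply/commuting_onP; split=> [j k|j]; rewrite !ffunE ?restr_perm_on //.
    by rewrite /commute -!morphM ?nO // cf.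
  have sg := (commuting_onP _ _ cg).2.
  have sh j : perm_on (S :\: O) (h j).
    apply/subsetP=> y; rewrite !inE ffunE permM.
    case Oy: (y \in O) => /=.
      by rewrite -gE ?permKV ?eqxx // (perm_closed _ (perm_onV (sg j))) Oy.
    rewrite (out_perm (perm_onV (sg j))) ?Oy //.
    by apply: contraR => Sy; rewrite (out_perm (sf j) Sy).
  have fE j : f j = g j * h j by rewrite [h j]ffunE mulKVg.
  have gh j k : commute (g j) (h k) by apply: perm_onC (sg j) (sh k) _.
  have ch : h \in commuting_on (S :\: O).
    apply/commuting_onP; split=> // j k; have := cf j k; rewrite !fE /commute.
    (* Both products are regrouped as an [O] part times a rest; the [O] parts commute and cancel. *)
    rewrite mulgACA; last exact/commute_sym/gh.
    rewrite [RHS]mulgACA; last exact/commute_sym/gh.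
    by rewrite (commuting_onP _ _ cg).1; apply: mulgI.
  exists (g, h); last by apply/ffunP=> j; rewrite ffunE.
  apply/setXP; split=> //; apply/transitive_onP; split=> //=.
  rewrite -[RHS]Of; apply: (@eq_orb _ _ _ O) => // j y Oy.
  by rewrite (perm_closed _ (sg j)).
case=> -[g h] /setXP[/= /transitive_onP[cg Og] ch] ->.
have [[cg' sg] [ch' sh]] := (commuting_onP _ _ cg, commuting_onP _ _ ch).
apply/setIdP; split.
  apply/commuting_onP; split=> [j k|j]; rewrite !ffunE /=.
    rewrite /commute mulgACA; last exact/commute_sym/com.
    rewrite [RHS]mulgACA; last exact/commute_sym/com.
    by rewrite cg' ch'.
  by apply: perm_onM; [apply: perm_on_sub (sg j)|apply: perm_on_sub (sh j)] => //;
    rewrite subsetDl.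
apply/eqP; rewrite -[RHS]Og; symmetry; apply: (@eq_orb _ _ _ O) => // j y Oy.
  by rewrite (perm_closed _ (sg j)).
by rewrite ffunE gO.
Qed.

Lemma card_commuting_on_rec S x : x \in S ->
  #|commuting_on S| =
    (\sum_(O : {set T} | (x \in O) && (O \subset S)) #|transitive_on x O| * #|commuting_on (S :\: O)|)%N.
Proof.
move=> Sx; rewrite -sum1_card.
rewrite (partition_big (fun f => orb f x) (fun O => (x \in O) && (O \subset S))) /=; last first.
  move=> f /commuting_onP[_ sf]; rewrite mem_orb; apply: orb_min => // j y Sy.
  by rewrite (perm_closed _ (sf j)).
apply: eq_bigr => O /andP[Ox sOS]; rewrite -card_commuting_on_orb // -sum1_card.
by apply: eq_bigl => f; rewrite inE.
Qed.

End CommutingTuples.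

(** * Regular abelian groups *)

Section RegularGroups.
Local Open Scope group_scope.
Variables (T : finType).
Implicit Types (O : {set T}) (x : T) (G H : {group {perm T}}).

Definition regular_groups x O :=
  [set G : {group {perm T}} | [&& abelian G, G \subset Sym O & orbit 'P G x == O]].

Lemma regular_groupsP x O G :
  reflect [/\ abelian G, {in G, forall p, perm_on O p} & orbit 'P G x = O]
          (G \in regular_groups x O).
Proof.
rewrite inE; apply: (iffP and3P) => [[aG /subsetP sG /eqP oG]|[aG sG oG]].
  by split=> // p /sG; rewrite inE.
by split=> //; [apply/subsetP=> p /sG; rewrite inE|apply/eqP].
Qed.

(** Elements of [G] that agree at [x] agree at [g x] for every [g] in [G], since [g] commutes with
    them, hence on all of [O]; off [O] both are the identity. *)
Lemma regular_group_inj x O G : G \in regular_groups x O ->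
  {in G &, injective (fun p : {perm T} => p x)}.
Proof.
case/regular_groupsP=> aG sG oG p p' Gp Gp' /= epx; apply/permP=> y.
case Oy: (y \in O); last by rewrite !(out_perm (sG _ _)) ?Oy.
move: Oy; rewrite -oG => /orbitP[g Gg <-]; rewrite /= /aperm -!permM.
by rewrite (centsP aG _ Gg _ Gp) (centsP aG _ Gg _ Gp') !permM epx.
Qed.

Lemma regular_group_onto x O G y : G \in regular_groups x O -> y \in O ->
  exists2 p, p \in G & p x = y.
Proof.
by case/regular_groupsP=> aG sG <- /orbitP[p Gp <-]; exists p.
Qed.

Lemma card_regular_group x O G : G \in regular_groups x O -> #|G| = #|O|.
Proof.
move=> RG; rewrite -(card_in_imset (regular_group_inj RG)).
by case/regular_groupsP: RG => _ _ <-.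
Qed.

Variable l : nat.
Implicit Type f : {ffun 'I_l -> {perm T}}.

Definition gen_tuples G := [set f : {ffun 'I_l -> {perm T}} | tuple_group f == G].

Lemma tuple_group_sub f G : (tuple_group f \subset G) = (f \in ffun_on (mem G)).
Proof.
rewrite gen_subG; apply/subsetP/ffun_onP => [sG j|fG _ /imsetP[j _ ->]] //.
by apply/sG/imset_f.
Qed.

Lemma card_sub_tuples G :
  (#|G| ^ l = \sum_(H : {group {perm T}} | H \subset G) #|gen_tuples H|)%N.
Proof.
rewrite -[in LHS](card_ord l) -card_ffun_on -sum1_card.
rewrite (partition_big (@tuple_group T l) (fun H => H \subset G)) /=; last first.
  by move=> f; rewrite tuple_group_sub.
apply: eq_bigr => H sHG; rewrite -sum1_card; apply: eq_bigl => f.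
rewrite [RHS]inE -tuple_group_sub andbC.
by case: eqP => [->|]; rewrite ?sHG.
Qed.

Lemma card_gen_tuples_le G : #|gen_tuples G| <= #|G| ^ l.
Proof. by rewrite card_sub_tuples (bigD1 G) //= leq_addr. Qed.

(** A tuple in [G] that does not generate [G] lies in a proper subgroup, of order at most
    [#|G| %/ 2] by Lagrange. The number of all groups is a crude bound on the number of subgroups,
    but independent of [l]. *)
Lemma card_gen_tuples_ge G :
  #|G| ^ l <= #|gen_tuples G| + #|{group {perm T}}| * (#|G| %/ 2) ^ l.
Proof.
rewrite card_sub_tuples (bigD1 G) //= leq_add2l.
apply: (@leq_trans (\sum_(H : {group {perm T}} | (H \subset G) && (H != G)) (#|G| %/ 2) ^ l)%N).
  apply: leq_sum => H /andP[sHG neHG]; apply: leq_trans (card_gen_tuples_le _) _.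
  case: l => // l'; rewrite leq_exp2r // leq_divRL // -(Lagrange sHG) leq_mul2l.
  rewrite indexg_gt1 [G \subset H](_ : _ = false) ?orbT //.
  by apply: contraNF neHG => sGH; rewrite -val_eqE /= eqEsubset sHG.
by rewrite sum_nat_const leq_mul2r max_card orbT.
Qed.

(** This turns the count of transitive tuples into a count of generating tuples of regular
    groups. *)
Lemma transitive_on_regular x O f :
  (f \in transitive_on l x O) = (tuple_group f \in regular_groups x O).
Proof.
apply/transitive_onP/regular_groupsP => [[/commuting_onP[cf sf] oO]|[aG sG oO]]; split=> //.
- rewrite /= abelian_gen; apply/centsP=> _ /imsetP[j _ ->] _ /imsetP[k _ ->].
  exact: cf.
- suff /subsetP sG : tuple_group f \subset Sym O by move=> p /sG; rewrite inE.
  by rewrite tuple_group_sub; apply/ffun_onP=> j; rewrite inE.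
apply/commuting_onP; split=> [j k|j]; last by rewrite sG ?mem_tuple_group.
by apply: (centsP aG); apply: mem_tuple_group.
Qed.

Lemma card_transitive_on x O :
  #|transitive_on l x O| = (\sum_(G in regular_groups x O) #|gen_tuples G|)%N.
Proof.
rewrite -sum1_card (partition_big (@tuple_group T l) (mem (regular_groups x O))) /=.
  apply: eq_bigr => G RG; rewrite -sum1_card; apply: eq_bigl => f.
  rewrite [RHS]inE transitive_on_regular andbC.
  by case: eqP => [->|]; rewrite ?RG.
by move=> f; rewrite transitive_on_regular.
Qed.

Lemma card_transitive_on_le x O :
  #|transitive_on l x O| <= #|regular_groups x O| * #|O| ^ l.
Proof.
rewrite card_transitive_on -sum_nat_const; apply: leq_sum => G RG.
by rewrite -(card_regular_group RG) card_gen_tuples_le.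
Qed.

(** Together with the upper bound this pins the count to [#|regular_groups x O| * #|O| ^ l], with an
    error whose exponential base is only [#|O| %/ 2]. *)
Lemma card_transitive_on_ge x O :
  #|regular_groups x O| * #|O| ^ l <=
    #|transitive_on l x O| +
      #|regular_groups x O| * (#|{group {perm T}}| * (#|O| %/ 2) ^ l).
Proof.
rewrite card_transitive_on -[X in X <= _]sum_nat_const -[X in _ <= _ + X]sum_nat_const.
rewrite -big_split /=; apply: leq_sum => G RG.
by rewrite -(card_regular_group RG) card_gen_tuples_ge.
Qed.

End RegularGroups.

(* [abelian_tables k] lists the Cayley tables of the abelian group laws on {0, ..., k-1}
   with neutral element 0; row i is the translation by i.  Associativity need not be
   tested: it follows from the commutation of the rows. *)
Fixpoint row_choices (rs : seq (seq (seq nat))) : seq (seq (seq nat)) :=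
  if rs is r :: rs' then [seq a :: t | a <- r, t <- row_choices rs'] else [:: [::]].

Definition entry (t : seq (seq nat)) i j := nth 0 (nth [::] t i) j.

Definition commuting_rows k t :=
  all (fun i => all (fun j => all (fun a =>
    entry t i (entry t j a) == entry t j (entry t i a)) (iota 0 k)) (iota 0 k)) (iota 0 k).

Definition abelian_tables k : seq (seq (seq nat)) :=
  [seq t <- row_choices [seq [seq r <- permutations (iota 0 k) | nth 0 r 0 == i]
                        | i <- iota 0 k]
  | commuting_rows k t].

Lemma mem_row_choices rs t : (t \in row_choices rs) = all2 (fun a r => a \in r) t rs.
Proof.
elim: rs t => [|r rs IH] [|a t] //=.
  by apply/allpairsP=> -[] [? ?] [].
apply/allpairsP/andP => [[[a' t'] /= [ra' rt' [-> ->]]]|[ra rt]].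
  by rewrite -IH.
by exists (a, t); rewrite /= IH.
Qed.

Lemma abelian_tablesP k t :
  reflect [/\ size t = k,
              forall i, i < k -> perm_eq (nth [::] t i) (iota 0 k),
              forall i, i < k -> entry t i 0 = i
            & forall i j a, i < k -> j < k -> a < k ->
                entry t i (entry t j a) = entry t j (entry t i a)]
          (t \in abelian_tables k).
Proof.
rewrite mem_filter mem_row_choices all2E size_map size_iota.
apply: (iffP idP).
  case/and3P=> /allP ct /eqP st /allP rt.
  have rowt i : i < k -> perm_eq (nth [::] t i) (iota 0 k) /\ entry t i 0 = i.
    move=> lt_ik; set rs := [seq _ | i <- _] in rt.
    have := rt (nth [::] t i, nth [::] rs i).
    rewrite -nth_zip ?size_map ?size_iota // mem_nth; last first.
      by rewrite size_zip size_map size_iota st minnn.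
    rewrite nth_zip ?size_map ?size_iota //= (nth_map 0) ?size_iota // nth_iota //.
    by move/(_ isT); rewrite mem_filter mem_permutations => /andP[/eqP].
  split=> // [i /rowt[]|i /rowt[]|i j a li lj la] //.
  have := ct i; rewrite mem_iota li => /(_ isT)/allP/(_ j).
  rewrite mem_iota lj => /(_ isT)/allP/(_ a).
  by rewrite mem_iota la => /(_ isT)/eqP.
case=> st pt t0 ct; apply/and3P; split; last 1 first.
- apply/(all_nthP ([::], [::])) => i; rewrite size_zip size_map size_iota st minnn => li.
  rewrite nth_zip ?size_map ?size_iota //= (nth_map 0) ?size_iota // nth_iota //.
  by rewrite mem_filter mem_permutations pt // andbT; apply/eqP/t0.
- apply/allP=> i; rewrite mem_iota => /= li; apply/allP=> j; rewrite mem_iota => /= lj.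
  by apply/allP=> a; rewrite mem_iota => /= la; apply/eqP/ct.
- by rewrite st.
Qed.

(** [x] comes first so that it has index 0, the neutral element of the tables. *)
Definition pointed_enum (T : finType) (x : T) (O : {set T}) := x :: enum (O :\ x).

(** * Regular abelian groups correspond to Cayley tables *)

Section Tables.
Local Open Scope group_scope.
Variables (T : finType) (x : T) (O : {set T}).
Hypothesis Ox : x \in O.
Implicit Types G : {group {perm T}}.

Let s := pointed_enum x O.
Let k := #|O|.

Let size_s : size s = k.
Proof. by rewrite /= -cardE [RHS](cardsD1 x) Ox. Qed.

Let uniq_s : uniq s.
Proof. by rewrite /s /pointed_enum /= enum_uniq mem_enum !inE eqxx. Qed.

Let mem_s y : (y \in s) = (y \in O).
Proof. by rewrite inE mem_enum !inE; case: eqP => // ->. Qed.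

Let nth_s0 : nth x s 0 = x.
Proof. by []. Qed.

Let idx_x : index x s = 0.
Proof. by rewrite /s /pointed_enum /= eqxx. Qed.

Let sK i : i < k -> index (nth x s i) s = i.
Proof. by move=> li; rewrite index_uniq // size_s. Qed.

Let nthO i : i < k -> nth x s i \in O.
Proof. by move=> li; rewrite -mem_s mem_nth // size_s. Qed.

Let idx_lt y : y \in O -> index y s < k.
Proof. by rewrite -mem_s -size_s index_mem. Qed.

Let idxK y : y \in O -> nth x s (index y s) = y.
Proof. by rewrite -mem_s => /nth_index->. Qed.

Let idx_inj : {in O &, injective (index^~ s)}.
Proof. by move=> y z Oy Oz e; rewrite -(idxK Oy) e idxK. Qed.

(** For [G] regular and [y] in [O] this is the one element of [G] taking [x] to [y]; the default [1]
    is then never reached. *)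
Definition translation G y : {perm T} := odflt 1 [pick p in G | p x == y].

(** The map sending [p] to [p x] carries the group law of [G] to [O], with neutral element [x]; this
    is its Cayley table, with points replaced by their indices. *)
Definition table G :=
  [seq [seq index (translation G y a) s | a <- s] | y <- s].

Lemma translationP G y : G \in regular_groups x O -> y \in O ->
  translation G y \in G /\ translation G y x = y.
Proof.
move=> RG Oy; rewrite /translation; case: pickP => [p /andP[Gp /eqP]|] //=.
by have [p Gp px] := regular_group_onto RG Oy => /(_ p); rewrite Gp px eqxx.
Qed.

Lemma entry_table G i j : i < k -> j < k ->
  entry (table G) i j = index (translation G (nth x s i) (nth x s j)) s.
Proof.
move=> li lj; rewrite /entry (nth_map x) ?size_s //.
by rewrite (nth_map x) ?size_s.
Qed.

Lemma table_abelian G : G \in regular_groups x O -> table G \in abelian_tables k.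
Proof.
move=> RG; have [aG sG oG] := regular_groupsP _ _ _ RG.
have trO y a : y \in O -> a \in O -> translation G y a \in O.
  by move=> Oy Oa; rewrite (perm_closed _ (sG _ (translationP RG Oy).1)).
apply/abelian_tablesP; split=> [|i li|i li|i j a li lj la].
- by rewrite size_map.
- rewrite (nth_map x) ?size_s //.
  (* The indices of [s] are [0, ..., k - 1], so the row is a permutation because [p] permutes
     [O]. *)
  have -> : iota 0 k = [seq index a s | a <- s].
    apply: (@eq_from_nth _ 0) => [|j]; rewrite size_iota ?size_map // => lj.
    by rewrite nth_iota // (nth_map x) ?size_s // sK.
  rewrite (map_comp (index^~ s)); apply: perm_map.
  have Hi := nthO li; set p := translation G _.
  have Gp : p \in G by have [] := translationP RG Hi.
  apply: uniq_perm => //; first by rewrite map_inj_uniq //; apply: perm_inj.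
  move=> y; rewrite mem_s; apply/mapP/idP => [[a]|Oy].
    by rewrite mem_s => Oa ->; apply: trO.
  exists (p^-1 y); last by rewrite permKV.
  by rewrite mem_s (perm_closed _ (perm_onV (sG _ Gp))).
- by rewrite entry_table ?(leq_ltn_trans _ li) // nth_s0 (translationP RG (nthO li)).2 sK.
have [[Oi Oj] Oa] := (nthO li, nthO lj, nthO la).
rewrite (entry_table _ lj) // (entry_table _ li la) !entry_table ?idx_lt ?trO //.
rewrite !idxK ?trO // -!permM (centsP aG _ (translationP RG Oi).1) //.
by case: (translationP RG Oj).
Qed.

(** The table determines every translation on [O], and each [p] in [G] is the translation to
    [p x]. *)
Lemma table_inj : {in regular_groups x O &, injective table}.
Proof.
have sub G G' : G \in regular_groups x O -> G' \in regular_groups x O ->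
    table G = table G' -> G \subset G'.
  move=> RG RG' eT; have [_ sG oG] := regular_groupsP _ _ _ RG.
  have [_ sG' _] := regular_groupsP _ _ _ RG'.
  apply/subsetP=> p Gp.
  have Opx : p x \in O by rewrite (perm_closed _ (sG _ Gp)).
  have [Gt tx] := translationP RG Opx; have [Gt' tx'] := translationP RG' Opx.
  rewrite -(regular_group_inj RG Gt Gp tx) (_ : translation _ _ = translation G' (p x)) //.
  apply/permP=> a; case Oa: (a \in O); last first.
    by rewrite (out_perm (sG _ Gt)) ?Oa // (out_perm (sG' _ Gt')) ?Oa.
  apply: idx_inj; rewrite ?(perm_closed _ (sG _ Gt)) ?(perm_closed _ (sG' _ Gt')) //.
  have := entry_table G (idx_lt Opx) (idx_lt Oa).
  by rewrite eT entry_table ?idx_lt // !idxK.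
move=> G G' RG RG' eT; apply/val_inj/eqP.
by rewrite eqEsubset (sub G G') // (sub G' G).
Qed.

(** Read on [O], the rows are commuting permutations and row [i] takes [x] to the point of index
    [i]. They generate a regular group, and by regularity its translations are the rows
    themselves. *)
Lemma table_onto t : t \in abelian_tables k ->
  exists2 G, G \in regular_groups x O & table G = t.
Proof.
case/abelian_tablesP=> st pt t0 ct.

have size_row i : i < k -> size (nth [::] t i) = k.
  by move=> /pt/perm_size; rewrite size_iota.
have lt_t i j : i < k -> j < k -> entry t i j < k.
  move=> li lj; have /perm_mem/(_ (entry t i j)) := pt _ li.
  by rewrite mem_iota mem_nth ?size_row //= add0n => <-.
have inj_t i j j' : i < k -> j < k -> j' < k -> entry t i j = entry t i j' -> j = j'.
  move=> li lj lj' /eqP; rewrite nth_uniq ?size_row //; first by move/eqP.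
  by rewrite (perm_uniq (pt _ li)) iota_uniq.
pose F (i : 'I_k) y := if y \in O then nth x s (entry t i (index y s)) else y.
have FO i y : (F i y \in O) = (y \in O).
  by rewrite /F; case: ifP => // Oy; rewrite nthO // lt_t ?idx_lt.
have F_inj i : injective (F i).
  move=> y z e; have := FO i y; rewrite e FO => Oyz; move: e; rewrite /F -Oyz.
  case: ifP => // Oz e; have Oy : y \in O by rewrite -Oyz.
  have := sK (lt_t _ _ (ltn_ord i) (idx_lt Oy)); rewrite e sK ?lt_t ?idx_lt //.
  by move/inj_t => e'; apply: idx_inj => //; rewrite e' ?idx_lt.
pose f : {ffun 'I_k -> {perm T}} := [ffun i => perm (@F_inj i)].
have fE i y : y \in O -> f i y = nth x s (entry t i (index y s)).
  by rewrite ffunE permE /F => ->.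
have fO i y : (f i y \in O) = (y \in O) by rewrite ffunE permE FO.
have sf i : perm_on O (f i).
  apply/subsetP=> y; rewrite inE; apply: contraNT => Oy.
  by rewrite ffunE permE /F (negPf Oy).
have fx i : f i x = nth x s i by rewrite fE // idx_x t0.
have Rf : tuple_group f \in regular_groups x O.
  rewrite -transitive_on_regular; apply/transitive_onP; split.
    apply/commuting_onP; split=> // i j; apply/permP=> y; rewrite !permM.
    case Oy: (y \in O); last by rewrite !(out_perm (sf _)) ?Oy.
    rewrite !fE ?nthO ?lt_t ?idx_lt // !sK ?lt_t ?idx_lt //.
    by rewrite ct ?idx_lt.
  apply/eqP; rewrite eqEsubset; apply/andP; split.
    by apply: orb_min => // j y; rewrite fO.
  apply/subsetP=> y Oy; rewrite -(idxK Oy).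
  by rewrite -(fx (Ordinal (idx_lt Oy))) orb_stable // mem_orb.
exists (tuple_group f) => //.
have trE (i : 'I_k) : translation (tuple_group f) (nth x s i) = f i.
  have Oi : nth x s i \in O by rewrite nthO.
  have [Gt tx] := translationP Rf Oi.
  by apply: (regular_group_inj Rf) => //=; rewrite ?mem_tuple_group // tx fx.
apply: (@eq_from_nth _ [::]); first by rewrite size_map size_s st.
move=> i; rewrite size_map size_s => li.
apply: (@eq_from_nth _ 0) => [|j].
  by rewrite (nth_map x) ?size_s // size_map size_s size_row.
rewrite (nth_map x) ?size_s // size_map size_s => lj.
rewrite (nth_map x) ?size_s // (trE (Ordinal li)) fE ?nthO // !sK //.
by rewrite lt_t.
Qed.

Lemma card_regular_groups : uniq (abelian_tables k) ->
  #|regular_groups x O| = size (abelian_tables k).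
Proof.
move=> uT; rewrite cardE -(size_map table); apply/perm_size/uniq_perm => //.
  rewrite map_inj_in_uniq ?enum_uniq // => G G'; rewrite !mem_enum.
  exact: table_inj.
move=> t; apply/mapP/idP => [[G]|/table_onto[G RG <-]].
  by rewrite mem_enum => /table_abelian RG ->.
by exists G; rewrite ?mem_enum.
Qed.

End Tables.

(** With the neutral element fixed, 2 or 3 points carry one abelian group law, and 4 points carry
    three cyclic ones and one Klein one; the tables are enumerated by computation. *)
Lemma card_regular_groups_small (T : finType) (x : T) (O : {set T}) :
  x \in O -> (1 < #|O| < 5)%N ->
  #|regular_groups x O| = if #|O| == 4 then 4 else 1%N.
Proof.
move=> Ox; have := card_regular_groups Ox.
by case: #|O| => [|[|[|[|[|n]]]]] // -> //; vm_compute.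
Qed.

(** * The limit polynomials *)

Section Phi.
Local Open Scope ring_scope.
Variable R : realFieldType.

(** The coefficient of [z^(3a)] in [exp(z^3/6)]. *)
Definition tri (a : nat) : R := (6 ^+ a * a`!%:R)^-1.

(** The coefficient of [z^(n - 2j)] in [exp(z^3/6)]; the test [2 * j <= n] guards against truncated
    subtraction. *)
Definition tri_part (n j : nat) : R :=
  if (2 * j <= n)%N && (3 %| n - 2 * j)%N then tri ((n - 2 * j) %/ 3) else 0.

(* The first coefficients of [exp(y/2 + y^2/6)]. *)
Definition pair_part (j : nat) : R :=
  nth 0 [:: 1; 1 / 2; 7 / 24; 5 / 48; 43 / 1152; 41 / 3840] j.

(* The coefficient of [z^n] in [exp(z^3/6 + X z^2/2 + X^2 z^4/6)], modulo [X^6]: put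
   [y = X z^2]. *)
Definition Phi (n : nat) (X : R) : R :=
  \sum_(j < 6) pair_part j * tri_part n j * X ^+ j.

Lemma tri_gt0 a : 0 < tri a.
Proof. by rewrite invr_gt0 mulr_gt0 ?exprn_gt0 ?ltr0n ?fact_gt0. Qed.

Lemma triS a : tri a.+1 = tri a / (6 * a.+1%:R).
Proof. by rewrite /tri factS natrM exprS mulrACA invfM mulrC. Qed.

Lemma tri_partE a j n : n = (3 * a + 2 * j)%N -> tri_part n j = tri a.
Proof. by move=> ->; rewrite /tri_part leq_addl addnK dvdn_mulr // mulKn. Qed.

Lemma tri_part_eq0 n j : n != 2 * j %[mod 3] -> tri_part n j = 0.
Proof. by move=> nj; rewrite /tri_part ifF //; apply: contraNF nj => /andP[? ?]; lia. Qed.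

(** Only the [j] with [2j] congruent to [n] modulo 3 survive: 0 and 3 here, 2 and 5 or 1 and 4 in
    the next two lemmas. *)
Lemma Phi_mod0 n X : (n %% 3 = 0)%N ->
  Phi n X = tri_part n 0 + 5 / 48 * tri_part n 3 * X ^+ 3.
Proof.
move=> n3; rewrite /Phi !big_ord_recr big_ord0 /= /pair_part /=.
rewrite (@tri_part_eq0 n 1) ?n3 // (@tri_part_eq0 n 2) ?n3 //.
by rewrite (@tri_part_eq0 n 4) ?n3 // (@tri_part_eq0 n 5) ?n3 //; ring.
Qed.

Lemma Phi_mod1 n X : (n %% 3 = 1)%N ->
  Phi n X = 7 / 24 * tri_part n 2 * X ^+ 2 + 41 / 3840 * tri_part n 5 * X ^+ 5.
Proof.
move=> n3; rewrite /Phi !big_ord_recr big_ord0 /= /pair_part /=.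
rewrite (@tri_part_eq0 n 0) ?n3 // (@tri_part_eq0 n 1) ?n3 //.
by rewrite (@tri_part_eq0 n 3) ?n3 // (@tri_part_eq0 n 4) ?n3 //; ring.
Qed.

Lemma Phi_mod2 n X : (n %% 3 = 2)%N ->
  Phi n X = 1 / 2 * tri_part n 1 * X + 43 / 1152 * tri_part n 4 * X ^+ 4.
Proof.
move=> n3; rewrite /Phi !big_ord_recr big_ord0 /= /pair_part /=.
rewrite (@tri_part_eq0 n 0) ?n3 // (@tri_part_eq0 n 2) ?n3 //.
by rewrite (@tri_part_eq0 n 3) ?n3 // (@tri_part_eq0 n 5) ?n3 //; ring.
Qed.

Definition Phi_sub (k n : nat) (X : R) : R := if (k <= n)%N then Phi (n - k) X else 0.

(** Multiplying the series by [z^2] raises [j] by one. *)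
Lemma tri_part_sub2 n j : (if (2 <= n)%N then tri_part (n - 2) j else 0) = tri_part n j.+1.
Proof.
rewrite /tri_part; have [n2|n2] := leqP 2 n; last by rewrite ifF //; lia.
have -> : (2 * j <= n - 2)%N = (2 * j.+1 <= n)%N by lia.
by have -> : (n - 2 - 2 * j = n - 2 * j.+1)%N by lia.
Qed.

Lemma tri_part_sub4 n j : (if (4 <= n)%N then tri_part (n - 4) j else 0) = tri_part n j.+2.
Proof.
rewrite /tri_part; have [n4|n4] := leqP 4 n; last by rewrite ifF //; lia.
have -> : (2 * j <= n - 4)%N = (2 * j.+2 <= n)%N by lia.
by have -> : (n - 4 - 2 * j = n - 2 * j.+2)%N by lia.
Qed.

(** Coefficient form of [z F' = (z^3/2) F] for [F = exp(z^3/6)]. *)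
Lemma tri_part_sub3 n j :
  1 / 2 * (if (3 <= n)%N then tri_part (n - 3) j else 0) = (n%:R - 2 * j%:R) * tri_part n j.
Proof.
rewrite /tri_part.
have [/andP[le2 /dvdnP[a ea]]|nd] := boolP ((2 * j <= n) && (3 %| n - 2 * j))%N; last first.
  rewrite mulr0; case: ifP => n3; last by rewrite mulr0.
  by rewrite ifF ?mulr0 //; apply: contraNF nd => /andP[? ?]; lia.
rewrite -natrM -natrB // ea mulnK //; case: a ea => [|a] ea.
  by rewrite mul0n mul0r; case: ifP => n3; rewrite ?mulr0 // ifF ?mulr0 //; lia.
have -> : (3 <= n)%N by lia.
have -> : (2 * j <= n - 3)%N by lia.
have -> : (n - 3 - 2 * j = a * 3)%N by lia.
rewrite dvdn_mull // mulnK //= /tri factS exprS !natrM -natr1.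
have : a`!%:R != 0 :> R by rewrite pnatr_eq0 -lt0n fact_gt0.
have : 6 ^+ a != 0 :> R by rewrite expf_neq0 ?pnatr_eq0.
move: (6 ^+ a) (a`!%:R) => u v u0 v0; field.
by rewrite u0 v0 andbT addrC natr1 pnatr_eq0.
Qed.

Lemma Phi_sub2E n X :
  Phi_sub 2 n X = \sum_(j < 6) pair_part j * tri_part n j.+1 * X ^+ j.
Proof.
rewrite /Phi_sub; under [RHS]eq_bigr do rewrite -tri_part_sub2.
by case: ifP => // _; rewrite big1 // => j _; rewrite mulr0 mul0r.
Qed.

Lemma Phi_sub4E n X :
  Phi_sub 4 n X = \sum_(j < 6) pair_part j * tri_part n j.+2 * X ^+ j.
Proof.
rewrite /Phi_sub; under [RHS]eq_bigr do rewrite -tri_part_sub4.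
by case: ifP => // _; rewrite big1 // => j _; rewrite mulr0 mul0r.
Qed.

Lemma Phi_sub3E n X :
  1 / 2 * Phi_sub 3 n X =
  \sum_(j < 6) pair_part j * ((n%:R - 2 * j%:R) * tri_part n j) * X ^+ j.
Proof.
rewrite /Phi_sub; under [RHS]eq_bigr do rewrite -tri_part_sub3.
case: ifP => _; last by rewrite mulr0 big1 // => j _; rewrite !mulr0 mul0r.
by rewrite mulr_sumr; apply: eq_bigr => j _; ring.
Qed.

(** Coefficient form of [z F' = (X z^2 + z^3/2 + 2/3 X^2 z^4) F] for the full exponential [F].
    Cutting [Phi] after [X^5] leaves the terms in [X^6] and [X^7]. *)
Lemma Phi_rec n X :
  X * Phi_sub 2 n X + 1 / 2 * Phi_sub 3 n X + 2 / 3 * X ^+ 2 * Phi_sub 4 n X =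
  n%:R * Phi n X
  + (41 / 3840 * tri_part n 6 + 2 / 3 * (43 / 1152) * tri_part n 6
     + 2 / 3 * (41 / 3840) * tri_part n 7 * X) * X ^+ 6.
Proof.
rewrite Phi_sub2E Phi_sub3E Phi_sub4E /Phi /pair_part !big_ord_recr !big_ord0 /=.
move: (tri_part n 0) (tri_part n 1) (tri_part n 2) (tri_part n 3) => t0 t1 t2 t3.
move: (tri_part n 4) (tri_part n 5) (tri_part n 6) (tri_part n 7) => t4 t5 t6 t7.
by field.
Qed.

End Phi.

(** * Asymptotics as l grows *)

Section Asymptotics.
Local Open Scope ring_scope.
Variables (R : archiRealFieldType) (b q r : R).
Hypotheses (b_gt0 : 0 < b) (b3 : b ^+ 3 = 3).
Hypotheses (qE : q = 2 / b ^+ 2) (rE : r = 5 / b ^+ 5).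

(** This bound and the next bracket the cube root of 3 tightly enough for what follows: [q < 1]
    needs [b^2 > 2], [r < q^5] needs [b^2 < 32/15], and [q^6 <= r] needs [b^2 <= 135/64]. *)
Let b_ge : 10/7 <= b.
Proof.
rewrite leNgt; apply/negP => blt.
have : b ^+ 3 < (10/7) ^+ 3 by rewrite ltrXn2r ?ltW //; lra.
by rewrite b3; lra.
Qed.

Let b_le : b <= 29/20.
Proof.
rewrite leNgt; apply/negP => blt.
have : (29/20) ^+ 3 < b ^+ 3 by rewrite ltrXn2r //; lra.
by rewrite b3; lra.
Qed.

Let b2_ge : 51/25 <= b ^+ 2.
Proof. by have := b_ge; nra. Qed.
Let b2_le : b ^+ 2 <= 421/200.
Proof. by have := b_le; have := b_ge; nra. Qed.
Let b4E : b ^+ 4 = 3 * b. Proof. by rewrite exprSr b3. Qed.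
Let b5E : b ^+ 5 = 3 * b ^+ 2. Proof. by rewrite -b3 -exprD. Qed.
Let b2_gt0 : 0 < b ^+ 2. Proof. exact: exprn_gt0. Qed.
Let b5_gt0 : 0 < b ^+ 5. Proof. exact: exprn_gt0. Qed.

Lemma q_gt0 : 0 < q. Proof. by rewrite qE divr_gt0. Qed.
Lemma r_gt0 : 0 < r. Proof. by rewrite rE divr_gt0. Qed.

Lemma q_lt1 : q < 1.
Proof. by rewrite qE ltr_pdivrMr // mul1r; have := b2_ge; lra. Qed.

Lemma r_lt1 : r < 1.
Proof. by rewrite rE ltr_pdivrMr // mul1r b5E; have := b2_ge; lra. Qed.

Lemma q5E : q ^+ 5 = 32 / (b ^+ 5 * b ^+ 5).
Proof.
rewrite qE expr_div_n -exprM -exprD.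
congr (_ / _); lra.
Qed.

Lemma q6E : q ^+ 6 = 64 / 81.
Proof.
rewrite qE expr_div_n -exprM -[(2 * 6)%N]/(3 * 4)%N exprM b3; lra.
Qed.

Lemma r_lt_q5 : r < q ^+ 5.
Proof.
rewrite q5E rE ltr_pdivrMr // invfM -!mulrA mulVf ?gt_eqF // mulr1.
by rewrite ltr_pdivlMr // b5E; have := b2_le; lra.
Qed.

Lemma q6_le_r : q ^+ 6 <= r.
Proof. by rewrite q6E rE ler_pdivlMr // b5E; have := b2_le; lra. Qed.

(** By the choice of [r], equality holds at [k = 5]; afterwards each step multiplies the right side
    by [b > 6/5], while the left side grows by a factor of at most [6/5]. *)
Lemma nat_le_bXr k : (4 < k)%N -> k%:R <= b ^+ k * r.
Proof.
move=> k_gt4; rewrite rE -(subnK k_gt4) exprD -mulrA [_ * (_ / _)]mulrC divfK ?gt_eqF //.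
elim: (k - 5)%N => [|m IH]; first by rewrite expr0 mul1r.
rewrite exprS addSn -natr1 -mulrA.
have : 5%:R <= (m + 5)%:R :> R by rewrite ler_nat leq_addl.
by have := b_ge; nra.
Qed.

(** For the orbit sizes with a main term, this controls the error left by non-generating tuples. *)
Lemma half_le_bXr k : (1 < k < 5)%N -> (k %/ 2)%:R <= b ^+ k * r.
Proof.
rewrite rE mulrA ler_pdivlMr // b5E; case: k => [|[|[|[|[|k]]]]] //= _.
- rewrite (_ : 2 %/ 2 = 1)%N //; have := b2_ge; lra.
- rewrite (_ : 3 %/ 2 = 1)%N // b3; have := b2_le; lra.
rewrite (_ : 4 %/ 2 = 2)%N // b4E expr2.
have : 0 <= b * (5 / 2 - b) by apply: mulr_ge0; [exact: ltW|have := b_le; lra].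
lra.
Qed.

(** * Calculus of errors of order [r^l] *)

Definition eqO (u v : nat -> R) := exists K, forall l, `|u l - v l| <= K * r ^+ l.
Definition bounded (u : nat -> R) := exists K, forall l, `|u l| <= K.

Lemma eq_eqO u v : u =1 v -> eqO u v.
Proof. by move=> e; exists 0 => l; rewrite e subrr normr0 mul0r. Qed.

Lemma eqO_trans u v w : eqO u v -> eqO v w -> eqO u w.
Proof.
move=> [K HK] [M HM]; exists (K + M) => l.
by rewrite (le_trans (ler_distD (v l) _ _)) // mulrDl lerD.
Qed.

Lemma eqOD u u' v v' :
  eqO u u' -> eqO v v' -> eqO (fun l => u l + v l) (fun l => u' l + v' l).
Proof.
move=> [K HK] [M HM]; exists (K + M) => l.
by rewrite opprD addrACA (le_trans (ler_normD _ _)) // mulrDl lerD.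
Qed.

Lemma eqO_sum (I : Type) (s : seq I) (P : pred I) (u v : I -> nat -> R) :
  (forall i, P i -> eqO (u i) (v i)) ->
  eqO (fun l => \sum_(i <- s | P i) u i l) (fun l => \sum_(i <- s | P i) v i l).
Proof.
move=> H; elim: s => [|i s IH]; first by apply: eq_eqO => l; rewrite !big_nil.
have e (w : I -> nat -> R) : (fun l => \sum_(j <- i :: s | P j) w j l) =1
    (fun l => (if P i then w i l else 0) + \sum_(j <- s | P j) w j l).
  by move=> l; rewrite big_cons; case: ifP; rewrite ?add0r.
apply: eqO_trans (eq_eqO (e u)) _; apply: eqO_trans; last first.
  by apply: eq_eqO => l; rewrite (e v).
apply: eqOD IH; case Pi: (P i); [exact: H|exact: eq_eqO].
Qed.

Lemma eqOM u u' v v' : bounded u' -> bounded v ->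
  eqO u u' -> eqO v v' -> eqO (fun l => u l * v l) (fun l => u' l * v' l).
Proof.
move=> [A HA] [B HB] [K HK] [M HM]; exists (K * B + A * M) => l.
have -> : u l * v l - u' l * v' l = (u l - u' l) * v l + u' l * (v l - v' l) by ring.
rewrite (le_trans (ler_normD _ _)) // !normrM mulrDl lerD //.
  by rewrite mulrAC ler_pM.
by rewrite -mulrA ler_pM.
Qed.

Lemma eqOZ c u v : eqO u v -> eqO (fun l => c * u l) (fun l => c * v l).
Proof.
move=> [K HK]; exists (`|c| * K) => l.
by rewrite -mulrBr normrM -mulrA ler_wpM2l.
Qed.

Lemma eqO_bounded u v : eqO u v -> bounded v -> bounded u.
Proof.
move=> [K HK] [M HM]; exists (`|K| + M) => l.
have -> : u l = (u l - v l) + v l by rewrite subrK.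
rewrite (le_trans (ler_normD _ _)) // lerD //; apply: le_trans (HK l) _.
rewrite (le_trans (ler_norm _)) // normrM -[leRHS]mulr1 ler_wpM2l //.
by rewrite ger0_norm ?exprn_ge0 ?exprn_ile1 ?ltW ?r_gt0 ?r_lt1.
Qed.

Lemma boundedD u v : bounded u -> bounded v -> bounded (fun l => u l + v l).
Proof.
move=> [A HA] [B HB]; exists (A + B) => l.
by rewrite (le_trans (ler_normD _ _)) ?lerD.
Qed.

Lemma boundedM u v : bounded u -> bounded v -> bounded (fun l => u l * v l).
Proof. by move=> [A HA] [B HB]; exists (A * B) => l; rewrite normrM ler_pM. Qed.

Lemma bounded_cst c : bounded (fun=> c).
Proof. by exists `|c|. Qed.

Lemma bounded_q : bounded (fun l => q ^+ l).
Proof.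
exists 1 => l; rewrite ger0_norm ?exprn_ge0 ?exprn_ile1 //;
  by rewrite ltW ?q_gt0 ?q_lt1.
Qed.

Lemma boundedX u n : bounded u -> bounded (fun l => u l ^+ n).
Proof.
move=> [A HA]; exists (A ^+ n) => l.
by rewrite normrX lerXn2r ?nnegrE // (le_trans _ (HA l)).
Qed.

(** Since [q^6 <= r], dropping the powers of [X] from [X^6] on stays within the error. *)
Lemma eqO_q6 u : bounded u -> eqO (fun l => u l * (q ^+ l) ^+ 6) (fun=> 0).
Proof.
move=> [A HA]; exists A => l; rewrite subr0 normrM ler_pM //.
rewrite ger0_norm ?exprn_ge0 ?(ltW q_gt0) // -exprM mulnC exprM.
by rewrite lerXn2r ?nnegrE ?exprn_ge0 ?(ltW q_gt0) ?(ltW r_gt0) ?q6_le_r.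
Qed.

(* The header's [s_l(k) / b^(kl)], up to [O(r^l)]. *)
Definition kern (k l : nat) : R :=
  match k with 2 => q ^+ l | 3 => 1 / 2 | 4 => 2 / 3 * (q ^+ l) ^+ 2 | _ => 0 end.

Lemma bounded_kern k : bounded (kern k).
Proof.
case: k => [|[|[|[|[|k]]]]] /=; try exact: bounded_cst; first exact: bounded_q.
exact: boundedM (bounded_cst _) (boundedX _ bounded_q).
Qed.

(** In the applications [c = (k - 1)!], [a = b^k], and [w] is the [l]-th power of a number at most
    [b^k r]. *)
Lemma eqO_dominated (u v w : nat -> R) (M c a : R) : 0 < c -> 0 < a ->
  0 <= M -> (forall l, `|u l - v l| <= M * w l) -> (forall l, 0 <= w l) ->
  (forall l, w l <= (a * r) ^+ l) ->
  eqO (fun l => u l / (c * a ^+ l)) (fun l => v l / (c * a ^+ l)).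
Proof.
move=> c_gt0 a_gt0 M_ge0 uv w_ge0 wr; exists (M / c) => l.
have ca_gt0 : 0 < c * a ^+ l by rewrite mulr_gt0 ?exprn_gt0.
rewrite -mulrBl normrM [X in _ * X]gtr0_norm ?invr_gt0 // ler_pdivrMr //.
apply: le_trans (uv l) _.
have -> : M / c * r ^+ l * (c * a ^+ l) = M * (a * r) ^+ l.
  by rewrite exprMn mulrACA divfK ?gt_eqF // [r ^+ l * _]mulrC.
by rewrite ler_wpM2l.
Qed.

(** For 2, 3 or 4 points the number of regular groups gives the main term; for other sizes the whole
    count is absorbed by the error. *)
Lemma transitive_on_asymp (T : finType) (x : T) (O : {set T}) : x \in O ->
  eqO (fun l => #|transitive_on l x O|%:R / ((#|O|.-1)`!%:R * b ^+ #|O| ^+ l)) (kern #|O|).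
Proof.
move=> Ox; set k := #|O|.
have k_gt0 : (0 < k)%N by rewrite /k (cardsD1 x) Ox.
have [/andP[k1 k5]|k_big] := boolP (1 < k < 5)%N.
  pose m : nat := if k == 4 then 4 else 1%N.
  have mE : #|regular_groups x O| = m by apply: card_regular_groups_small; rewrite ?k1.
  pose M := (m * #|{group {perm T}}|)%N.
  apply: (@eqO_trans _ (fun l => (m%:R * k%:R ^+ l) / ((k.-1)`!%:R * b ^+ k ^+ l))).
    apply: (@eqO_dominated _ _ (fun l => (k %/ 2)%:R ^+ l) M%:R);
      rewrite ?ltr0n ?fact_gt0 ?exprn_gt0 ?ler0n //; move=> l.
    - have := card_transitive_on_ge l x O; have := card_transitive_on_le l x O.
      rewrite mE -/k mulnA -/M -!(ler_nat R) !(natrD, natrM, natrX) => h1 h2.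
      have h3 : 0 <= M%:R * (k %/ 2)%:R ^+ l :> R by rewrite mulr_ge0 ?exprn_ge0.
      by rewrite ler_norml; apply/andP; split; lra.
    - by rewrite exprn_ge0.
    - rewrite lerXn2r ?nnegrE ?mulr_ge0 ?exprn_ge0 ?(ltW b_gt0) ?(ltW r_gt0) //.
      by rewrite half_le_bXr ?k1.
  apply: eq_eqO => l; rewrite /m; move: k1 k5; case: (k) => [|[|[|[|[|]]]]] //= _ _.
  - by rewrite qE expr_div_n mul1r [1%:R]/1 mul1r.
  - rewrite b3 (_ : 2`! = 2)%N //.
    have : 3 ^+ l != 0 :> R by rewrite expf_neq0 ?pnatr_eq0.
    by move: (3 ^+ l) => A A0; field.
  - rewrite (exprM b 2 2) exprAC qE expr_div_n [4 ^+ l](_ : _ = (2 ^+ l) ^+ 2); last first.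
      by rewrite -!natrX -[4%N]/(2 ^ 2)%N -!expnM mulnC.
    rewrite (_ : 3`! = 6)%N //.
    have : (b ^+ 2) ^+ l != 0 by rewrite expf_neq0 ?gt_eqF.
    by move: (2 ^+ l) ((b ^+ 2) ^+ l) => A B B0; field.
have kern0 : kern k = fun=> 0.
  by move: k_gt0 k_big; case: (k) => [|[|[|[|[|]]]]].
rewrite kern0; apply: (@eqO_trans _ (fun l => 0 / ((k.-1)`!%:R * b ^+ k ^+ l))); last first.
  by apply: eq_eqO => l; rewrite mul0r.
apply: (@eqO_dominated _ _ (fun l => k%:R ^+ l) #|regular_groups x O|%:R);
  rewrite ?ltr0n ?fact_gt0 ?exprn_gt0 ?ler0n //; move=> l.
- by rewrite subr0 ger0_norm // -natrX -natrM ler_nat card_transitive_on_le.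
- by rewrite exprn_ge0.
rewrite lerXn2r ?nnegrE ?mulr_ge0 ?exprn_ge0 ?(ltW b_gt0) ?(ltW r_gt0) //.
have [k4|k4] := ltnP 4 k; first exact: nat_le_bXr.
(* A single point contributes [1 / b^l], which is an error term because [b < 5/3] gives
   [1 / b <= r]. *)
have -> : k = 1%N by move: k_gt0 k_big k4; case: (k) => [|[|[|[|[|]]]]].
rewrite rE mulrA ler_pdivlMr // b5E expr1 expr2.
have : 0 <= b * (5 / 3 - b) by apply: mulr_ge0; [exact: ltW|have := b_le; lra].
lra.
Qed.

Lemma sum_kern n l X : X = q ^+ l -> (0 < n)%N ->
  \sum_(k < n) kern k.+1 l * Phi (n.-1 - k) X =
  X * Phi_sub 2 n X + 1 / 2 * Phi_sub 3 n X + 2 / 3 * X ^+ 2 * Phi_sub 4 n X.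
Proof.
(* The values 1, 2, 3 of [n] are separate because there the guards of [Phi_sub] remove some of the
   three terms. *)
move=> XE; rewrite /Phi_sub; case: n => [|[|[|[|n]]]] // _.
- by rewrite big_ord_recl big_ord0 /= !mulr0 mul0r !addr0.
- by rewrite !big_ord_recl big_ord0 /= /bump /= !subSS !subn0 -XE !mulr0 !mul0r !addr0 add0r.
- by rewrite !big_ord_recl big_ord0 /= /bump /= !subSS !subn0 -XE !mulr0 !mul0r !addr0 add0r.
rewrite !big_ord_recl big1 /= => [|i _]; last by rewrite mul0r.
by rewrite /bump /= !subSS !subn0 -XE !mul0r !addr0 !add0r addrA.
Qed.

Lemma Phi_bounded n : bounded (fun l => Phi n (q ^+ l)).
Proof.
exists (\sum_(j < 6) `|pair_part R j * tri_part R n j|) => l.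
rewrite (le_trans (ler_norm_sum _ _ _)) //; apply: ler_sum => j _.
rewrite normrM -[leRHS]mulr1 ler_wpM2l // normrX exprn_ile1 //.
rewrite ger0_norm ?exprn_ge0 ?exprn_ile1 ?ltW //.
all: by rewrite ?q_gt0 ?q_lt1.
Qed.

(** The limit polynomials obey, up to the error, the same recursion as the normalised counts. *)
Lemma Phi_rec_eqO n : (0 < n)%N ->
  eqO (fun l => n%:R^-1 * \sum_(k < n) kern k.+1 l * Phi (n.-1 - k) (q ^+ l))
        (fun l => Phi n (q ^+ l)).
Proof.
move=> n_gt0; have Hq := bounded_q.
pose E l : R := 41 / 3840 * tri_part R n 6 + 2 / 3 * (43 / 1152) * tri_part R n 6
     + 2 / 3 * (41 / 3840) * tri_part R n 7 * q ^+ l.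
have bE : bounded E.
  apply: boundedD (bounded_cst _) _; exact: boundedM (bounded_cst _) Hq.
apply: (@eqO_trans _ (fun l => Phi n (q ^+ l) + n%:R^-1 * (E l * (q ^+ l) ^+ 6))).
  apply: eq_eqO => l; rewrite (sum_kern (erefl _)) // Phi_rec mulrDr mulKf //.
  by rewrite pnatr_eq0 -lt0n.
apply: (@eqO_trans _ (fun l => Phi n (q ^+ l) + n%:R^-1 * 0)); last first.
  by apply: eq_eqO => l; rewrite mulr0 addr0.
apply: eqOD; first exact: eq_eqO.
exact/eqOZ/eqO_q6.
Qed.

(** * Induction for the normalised counts *)

Lemma sum_pointed_subsets (T : finType) (S : {set T}) (x : T) (psi : nat -> R) : x \in S ->
  \sum_(O : {set T} | (x \in O) && (O \subset S)) psi #|O| =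
  \sum_(k < #|S|) 'C(#|S|.-1, k)%:R * psi k.+1.
Proof.
move=> Sx; have S_gt0 : (0 < #|S|)%N by rewrite (cardsD1 x) Sx.
pose n := #|S|.-1; have nE : #|S| = n.+1 by rewrite prednK.
rewrite nE (partition_big (fun O : {set T} => inord #|O|.-1 : 'I_n.+1) predT) //=.
(* A set [O] of size [k + 1] containing [x] is [x] together with a [k]-subset of the other
   points. *)
apply: eq_bigr => k _; pose D := [set B : {set T} | B \subset S :\ x & #|B| == k].
have Dx B : B \in D -> x \notin B.
  by rewrite inE => /andP[/subsetP sB _]; apply/negP=> /sB; rewrite !inE eqxx.
have cD : #|D| = 'C(n, k) by rewrite cards_draws; congr 'C(_, _); rewrite /n (cardsD1 x S) Sx.
have injD : {in D &, injective (fun B => x |: B)}.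
  by move=> B B' /Dx xB /Dx xB' /(congr1 (fun C => C :\ x)); rewrite !setU1K.
rewrite (eq_bigl (mem [set x |: B | B in D])) => [|O]; last first.
  apply/andP/imsetP => [[/andP[Ox sOS] /eqP kE]|[B DB ->]].
    exists (O :\ x); last by rewrite setD1K.
    rewrite inE setSD //= -kE inordK; first by rewrite [#|O|](cardsD1 x) Ox.
    by rewrite -nE prednK ?(subset_leq_card sOS) // (cardsD1 x) Ox.
  have xB := Dx _ DB; move: DB; rewrite inE => /andP[sB /eqP cB].
  rewrite setU11 cardsU1 xB /= cB; split; last by rewrite inord_val.
  by rewrite subUset sub1set Sx (subset_trans sB) ?subD1set.
rewrite big_imset //= -cD mulr_natl -sumr_const; apply: eq_bigr => B DB.
by rewrite cardsU1 (Dx _ DB); move: DB; rewrite inE => /andP[_ /eqP->].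
Qed.

(** For [n = #|S|] this is [N_l(n) / b^(nl)]. *)
Definition scaled (T : finType) (S : {set T}) l : R :=
  #|commuting_on l S|%:R / (#|S|`!%:R * b ^+ #|S| ^+ l).

Lemma commuting_on_set0 (T : finType) l : #|commuting_on l (set0 : {set T})| = 1%N.
Proof.
rewrite (_ : commuting_on l set0 = [set [ffun=> 1%g]]) ?cards1 //.
apply/setP=> f; rewrite in_set1; apply/commuting_onP/eqP => [[_ sf]|->].
  by apply/ffunP=> j; rewrite ffunE (perm_on_id (sf j)) ?cards0.
by split=> [j k|j]; rewrite !ffunE ?perm_on1.
Qed.

Lemma scaled_rec (T : finType) (S : {set T}) (x : T) l : x \in S ->
  scaled S l = \sum_(O : {set T} | (x \in O) && (O \subset S))
    ((#|O|.-1)`!%:R * (#|S| - #|O|)`!%:R / #|S|`!%:R) *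
    (#|transitive_on l x O|%:R / ((#|O|.-1)`!%:R * b ^+ #|O| ^+ l) * scaled (S :\: O) l).
Proof.
move=> Sx; rewrite /scaled (card_commuting_on_rec _ Sx) natr_sum mulr_suml.
apply: eq_bigr => O /andP[Ox sOS]; rewrite cardsDS //.
have kn := subset_leq_card sOS; rewrite natrM.
have -> : b ^+ #|S| ^+ l = b ^+ #|O| ^+ l * b ^+ (#|S| - #|O|) ^+ l.
  by rewrite -exprMn -exprD subnKC.
have f0 m : m`!%:R != 0 :> R by rewrite pnatr_eq0 -lt0n fact_gt0.
have b0 m : (b ^+ m) ^+ l != 0 by rewrite !expf_neq0 ?gt_eqF.
move: (f0 #|O|.-1) (f0 #|S|) (f0 (#|S| - #|O|)%N) (b0 #|O|) (b0 (#|S| - #|O|)%N).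
set A := _`!%:R; set B := _`!%:R; set C := _`!%:R; set D := _ ^+ l; set E := _ ^+ l.
move=> A0 B0 C0 D0 E0; field.
by rewrite A0 B0 C0 D0 E0.
Qed.

(** Strong induction over all types and sets at once: removing the orbit of [x] leaves a smaller
    set, and the main terms then satisfy the recursion of [Phi]. *)
Lemma scaled_asymp n (T : finType) (S : {set T}) : #|S| = n ->
  eqO (scaled S) (fun l => Phi n (q ^+ l)).
Proof.
elim/ltn_ind: n T S => -[_|n IH] T S cS.
  apply: eq_eqO => l; rewrite /scaled cS (cards0_eq cS) commuting_on_set0 expr0 expr1n fact0 mulr1 divr1.
  rewrite /Phi !big_ord_recr !big_ord0 /= /tri_part /tri /= fact0 !mulr0 !mul0r.
  by rewrite !mulr1 !addr0 add0r invr1 mulr1.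
have [x Sx] : exists x, x \in S by apply/set0Pn; rewrite -card_gt0 cS.
apply: eqO_trans (eq_eqO (fun l => scaled_rec l Sx)) _.
apply: eqO_trans _ (Phi_rec_eqO (ltn0Sn n)).
have IHO (O : {set T}) : x \in O -> O \subset S ->
    eqO (scaled (S :\: O)) (fun l => Phi (n.+1 - #|O|) (q ^+ l)).
  move=> Ox sOS; apply: IH; last by rewrite cardsDS // cS.
  by rewrite ltn_subrL andbT (cardsD1 x) Ox.
pose psi l k := k.-1`!%:R * (n.+1 - k)`!%:R / n.+1`!%:R * (kern k l * Phi (n.+1 - k) (q ^+ l)).
apply: (@eqO_trans _ (fun l => \sum_(O : {set T} | (x \in O) && (O \subset S)) psi l #|O|)).
  apply: eqO_sum => O /andP[Ox sOS]; rewrite cS; apply: eqOZ; apply: eqOM.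
  - exact: bounded_kern.
  - exact: eqO_bounded (IHO O Ox sOS) (Phi_bounded _).
  - exact: transitive_on_asymp.
  exact: IHO.
apply: eq_eqO => l; rewrite sum_pointed_subsets // cS mulr_sumr.
apply: eq_bigr => k _; rewrite /psi /= subSS mulrA; congr (_ * _).
have kn : (k <= n)%N by rewrite -ltnS.
(* The ['C(n, k)] choices of [O] cancel all factorials except a factor [1 / (n + 1)]. *)
rewrite mulrA -!natrM bin_fact // factS natrM invfM mulrCA divff ?mulr1 //.
by rewrite pnatr_eq0 -lt0n fact_gt0.
Qed.

(** * Reading the sign off the leading term *)

Lemma geometric_small (rho C d : R) : 0 <= rho < 1 -> 0 < d ->
  exists L, forall l, (L <= l)%N -> C * rho ^+ l < d.
Proof.
case/andP=> rho_ge0 rho_lt1 d_gt0.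
have [C_le0|C_gt0] := lerP C 0.
  exists 0%N => l _; apply: le_lt_trans d_gt0; rewrite mulr_le0_ge0 ?exprn_ge0 //.
have [->|rho_neq0] := eqVneq rho 0.
  by exists 1%N => -[|l] // _; rewrite exprS mul0r mulr0.
have rho_gt0 : 0 < rho by rewrite lt_def rho_neq0.
(* Bernoulli's inequality makes [rho^-l] grow at least linearly with slope [c], so any
   [l > C / (d c)] will do. *)
pose c := rho^-1 - 1; have c_gt0 : 0 < c by rewrite subr_gt0 invf_gt1.
have bern l : 1 + l%:R * c <= rho^-1 ^+ l.
  elim: l => [|l IH]; first by rewrite mul0r addr0 expr0.
  have rV : rho^-1 = 1 + c by rewrite /c addrC subrK.
  have c_ge0 := ltW c_gt0; have : 0 <= l%:R * c * c by rewrite !mulr_ge0.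
  rewrite exprS -natr1 {1}rV => h.
  have : 0 <= (1 + c) * (rho^-1 ^+ l - (1 + l%:R * c)).
    by rewrite mulr_ge0 ?subr_ge0 // addr_ge0.
  by move: (rho^-1 ^+ l) h => u h; nra.
exists (Num.bound (C / (d * c))) => l Ll.
have : C / (d * c) < l%:R.
  apply: lt_le_trans (_ : (Num.bound (C / (d * c)))%:R <= _); last by rewrite ler_nat.
  by rewrite archi_boundP // divr_ge0 ?mulr_ge0 ?ltW.
rewrite ltr_pdivrMr ?mulr_gt0 // => h.
have p_gt0 : 0 < rho ^+ l by rewrite exprn_gt0.
rewrite -ltr_pdivlMr // -exprVn; apply: lt_le_trans h _.
rewrite mulrCA ler_wpM2l ?(ltW d_gt0) //; apply: le_trans (bern l).
by rewrite lerDr.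
Qed.

(** The leading term [d X^j] beats the correction because [X] tends to 0, and the error because
    [r < q^5] and [j <= 5]. *)
Lemma eventually_pos (D E : nat -> R) (d : R) j : (j <= 5)%N -> 0 < d -> bounded E ->
  eqO D (fun l => (q ^+ l) ^+ j * (d + q ^+ l * E l)) ->
  exists L, forall l, (L <= l)%N -> 0 < D l.
Proof.
move=> j5 d_gt0 [M HM] [K HK].
have [q0 q1 r0 rq] := And4 q_gt0 q_lt1 r_gt0 r_lt_q5.
have q5_gt0 : 0 < q ^+ 5 by rewrite exprn_gt0.
(* One ratio below 1 that governs both the correction, through [q], and the error relative to [X^5],
   through [r / q^5]. *)
pose rho := Num.max q (r / q ^+ 5).
have qrho : q <= rho by rewrite le_max lexx.
have rrho : r <= rho * q ^+ 5 by rewrite -ler_pdivrMr // le_max lexx orbT.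
have [|L HL] := @geometric_small rho (`|M| + `|K|) d _ d_gt0.
  by rewrite (le_trans (ltW q0)) //= gt_max q1 ltr_pdivrMr // mul1r.
exists L => l /HL {HL} small.
have x_gt0 : 0 < q ^+ l by rewrite exprn_gt0.
have x_le1 : q ^+ l <= 1 by rewrite exprn_ile1 ?ltW.
have rho_ge0 : 0 <= rho by rewrite (le_trans (ltW q0)).
have xrho : q ^+ l <= rho ^+ l by rewrite lerXn2r ?nnegrE // ltW.
have rl : r ^+ l <= rho ^+ l * (q ^+ l) ^+ j.
  apply: (@le_trans _ _ ((rho * q ^+ 5) ^+ l)).
    by rewrite lerXn2r ?nnegrE ?mulr_ge0 // ltW.
  rewrite exprMn [_ ^+ 5 ^+ l]exprAC; apply: ler_wpM2l; first exact: exprn_ge0.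
  by apply: ler_wiXn2l => //; apply: ltW.
have xj_gt0 : 0 < (q ^+ l) ^+ j by rewrite exprn_gt0.
move: (HK l) (HM l); rewrite !ler_norml => /andP[HD _] /andP[HE _].
move: xj_gt0 x_gt0 x_le1 xrho rl small HD HE.
have r_ge0 : 0 <= r ^+ l by rewrite exprn_ge0 ?ltW.
have rho_l : 0 <= rho ^+ l by rewrite exprn_ge0.
move: r_ge0 rho_l; move: ((q ^+ l) ^+ j) => y.
move: (q ^+ l) (rho ^+ l) (r ^+ l) (D l) (E l) => x p s u e.
move=> s_ge0 p_ge0 y_gt0 x_gt0 x_le1 xp sy small HD HE.
have [nM nK] := (ler_norm M, ler_norm K).
have h1 : - (`|M| * p) <= x * e.
  have : 0 <= x * (e + `|M|) by rewrite mulr_ge0 ?(ltW x_gt0) //; lra.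
  have : 0 <= `|M| * (p - x) by rewrite mulr_ge0 // subr_ge0.
  lra.
have h2 : K * s <= `|K| * p * y.
  apply: (@le_trans _ _ (`|K| * s)); first by rewrite ler_wpM2r.
  by rewrite -mulrA ler_wpM2l.
have h3 : 0 < y * (d - (`|M| + `|K|) * p) by rewrite mulr_gt0 // subr_gt0.
have h4 : 0 <= y * (x * e + `|M| * p) by rewrite mulr_ge0 ?(ltW y_gt0) //; lra.
lra.
Qed.

End Asymptotics.

(** * The sign of Delta *)

Section Sign.
Local Open Scope ring_scope.
Variables (R : archiRealFieldType) (b q r : R).
Hypotheses (b_gt0 : 0 < b) (b3 : b ^+ 3 = 3).
Hypotheses (qE : q = 2 / b ^+ 2) (rE : r = 5 / b ^+ 5).

Definition scaled_Delta n l : R :=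
  scaled b [set: 'I_n] l ^+ 2 - scaled b [set: 'I_n.-1] l * scaled b [set: 'I_n.+1] l.

Lemma scaled_Nl n l : ratr (Nl l n) = scaled b [set: 'I_n] l * b ^+ n ^+ l.
Proof.
rewrite /Nl /scaled cardsT card_ord fmorph_div /= !ratr_nat.
rewrite card_Sn.
have -> : commuting_tuples l n = commuting_on l [set: 'I_n].
  apply/setP=> f; rewrite !inE andbC [supported _ _](_ : _ = true) //.
  by apply/forallP=> j; apply/subsetP=> y; rewrite !inE.
by rewrite invfM mulrA divfK // !expf_neq0 ?gt_eqF.
Qed.

(** The powers of [b] in the two products agree, as [(n - 1) + (n + 1) = 2n], so scaling preserves
    the sign. *)
Lemma ratr_Delta n l : (0 < n)%N ->
  ratr (Delta l n) = scaled_Delta n l * (b ^+ n ^+ l) ^+ 2.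
Proof.
move=> n_gt0; rewrite /Delta rmorphB rmorphXn (rmorphM _ (Nl l n.-1)) /= !scaled_Nl /scaled_Delta.
have e : b ^+ n.-1 ^+ l * b ^+ n.+1 ^+ l = (b ^+ n ^+ l) ^+ 2.
  rewrite -[LHS]exprMn -exprD [RHS]exprAC -[b ^+ n ^+ 2]exprM; congr (_ ^+ _ ^+ _); lia.
by rewrite mulrACA e exprMn mulrBl.
Qed.

Definition Phi_Delta n (X : R) := Phi n X ^+ 2 - Phi n.-1 X * Phi n.+1 X.

Lemma scaled_Delta_asymp n :
  eqO r (scaled_Delta n) (fun l => Phi_Delta n (q ^+ l)).
Proof.
have F m : eqO r (scaled b [set: 'I_m]) (fun l => Phi m (q ^+ l)).
  by apply: (scaled_asymp b_gt0 b3 qE rE); rewrite cardsT card_ord.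
have PB m := @Phi_bounded R b q b_gt0 b3 qE m.
have SB m := eqO_bounded b_gt0 b3 rE (F m) (PB m).
have N c u v : eqO r u v -> eqO r (fun l => c * u l) (fun l => c * v l) by apply: eqOZ.
have M m p : eqO r (fun l => scaled b [set: 'I_m] l * scaled b [set: 'I_p] l)
                   (fun l => Phi m (q ^+ l) * Phi p (q ^+ l)).
  by apply: (eqOM (r := r) (PB m) (SB p) (F m) (F p)).
rewrite /scaled_Delta /Phi_Delta.
have := eqOD (M n n) (N (-1) _ _ (M n.-1 n.+1)).
move/eqO_trans=> H; apply: eqO_trans (H _ (eq_eqO _ _)) => [|l].
  by apply: eq_eqO => l; rewrite mulN1r.
by rewrite mulN1r.
Qed.

(** The exponents in each [Phi] differ by 3, so those in [Phi_Delta] advance by 3 from the leading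
    one; this is the remainder with one factor [X] split off. *)
Lemma bounded_E c1 c2 c3 : bounded
  (fun l => c1 * (q ^+ l) ^+ 2 + c2 * (q ^+ l) ^+ 5 + c3 * (q ^+ l) ^+ 8).
Proof.
have H c k : bounded (fun l => c * (q ^+ l) ^+ k).
  exact: boundedM (bounded_cst _) (boundedX _ (bounded_q b_gt0 b3 qE)).
exact: boundedD (boundedD (H _ _) (H _ _)) (H _ _).
Qed.

Lemma Delta_pos n j d c1 c2 c3 : (0 < n)%N -> (j <= 5)%N -> 0 < d ->
  (forall X, Phi_Delta n X = X ^+ j * (d + X * (c1 * X ^+ 2 + c2 * X ^+ 5 + c3 * X ^+ 8))) ->
  exists L, forall l, (L <= l)%N -> 0 < Delta l n.
Proof.
move=> n_gt0 j5 d_gt0 PE.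
have [|L HL] := @eventually_pos R b q r b_gt0 b3 qE rE _ _ d j j5 d_gt0 (bounded_E c1 c2 c3)
  (_ : eqO r (scaled_Delta n) _).
  by apply: eqO_trans (scaled_Delta_asymp n) _; apply: eq_eqO => l; apply: PE.
exists L => l /HL; rewrite -(ltr0q R) ratr_Delta // => H.
by rewrite mulr_gt0 // !exprn_gt0.
Qed.

Lemma Delta_neg n j d c1 c2 c3 : (0 < n)%N -> (j <= 5)%N -> d < 0 ->
  (forall X, Phi_Delta n X = X ^+ j * (d + X * (c1 * X ^+ 2 + c2 * X ^+ 5 + c3 * X ^+ 8))) ->
  exists L, forall l, (L <= l)%N -> Delta l n < 0.
Proof.
move=> n_gt0 j5; rewrite -oppr_gt0 => d_gt0 PE.
have [|L HL] := @eventually_pos R b q r b_gt0 b3 qE rE _ _ (- d) j j5 d_gt0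
  (bounded_E (- c1) (- c2) (- c3)) (_ : eqO r (fun l => -1 * scaled_Delta n l) _).
  apply: eqO_trans (eqOZ (-1) (scaled_Delta_asymp n)) _; apply: eq_eqO => l.
  by rewrite PE; ring.
exists L => l /HL; rewrite mulN1r oppr_gt0 -(ltrq0 R) ratr_Delta // => H.
by rewrite pmulr_llt0 // !exprn_gt0.
Qed.

(** [Phi n] has a positive constant term, while the product of its neighbours starts at [X^3]. *)
Lemma Delta_mod0 n : (1 < n)%N -> (n %% 3 = 0)%N ->
  exists L, forall l, (L <= l)%N -> 0 < Delta l n.
Proof.
move=> n_gt1 n0; pose t m j := tri_part R m j.
apply: (@Delta_pos n 0 (t n 0%N ^+ 2)
   (2 * t n 0%N * (5 / 48 * t n 3) - 1 / 2 * t n.-1 1 * (7 / 24 * t n.+1 2))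
   ((5 / 48 * t n 3) ^+ 2 - 1 / 2 * t n.-1 1 * (41 / 3840 * t n.+1 5)
      - 43 / 1152 * t n.-1 4 * (7 / 24 * t n.+1 2))
   (- (43 / 1152 * t n.-1 4 * (41 / 3840 * t n.+1 5)))) => //; first exact: ltnW.
  by rewrite /t (@tri_partE _ (n %/ 3)) ?exprn_gt0 ?tri_gt0 //; lia.
by move=> X; rewrite /Phi_Delta Phi_mod0 // Phi_mod2 ?Phi_mod1 /t; [ring|lia|lia].
Qed.

(** The square of [Phi n] starts at [X^4], while the product of its neighbours starts at [X]. *)
Lemma Delta_mod1 n : (1 < n)%N -> (n %% 3 = 1)%N ->
  exists L, forall l, (L <= l)%N -> Delta l n < 0.
Proof.
move=> n_gt1 n1; pose t m j := tri_part R m j.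
(* Lower and higher coefficients of [Phi] at [n]; one prime stands for [n - 1], two for [n + 1]. *)
pose A := 7 / 24 * t n 2; pose B := 41 / 3840 * t n 5.
pose A' := t n.-1 0%N; pose B' := 5 / 48 * t n.-1 3.
pose A'' := 1 / 2 * t n.+1 1; pose B'' := 43 / 1152 * t n.+1 4.
apply: (@Delta_neg n 1 (- (A' * A''))
   (A ^+ 2 - A' * B'' - B' * A'') (2 * A * B - B' * B'') (B ^+ 2)) => //; first exact: ltnW.
  rewrite oppr_lt0 /A' /A'' /t (@tri_partE _ (n %/ 3)) ?(@tri_partE _ (n %/ 3)); try lia.
  by rewrite !mulr_gt0 ?tri_gt0 ?invr_gt0.
move=> X; rewrite /Phi_Delta Phi_mod1 // Phi_mod0 ?Phi_mod2; try lia.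
by rewrite /A /B /A' /B' /A'' /B'' /t; ring.
Qed.

Section Mod2.
Variable m : nat.
Let n := (3 * m + 2)%N.
Let t k j := tri_part R k j.
Let A := 1 / 2 * t n 1.
Let B := 43 / 1152 * t n 4.
Let A' := 7 / 24 * t n.-1 2.
Let B' := 41 / 3840 * t n.-1 5.
Let A'' := t n.+1 0%N.
Let B'' := 5 / 48 * t n.+1 3.

Let Phi_DeltaE X : Phi_Delta n X =
  (A ^+ 2 - A' * A'') * X ^+ 2 + (2 * A * B - A' * B'' - B' * A'') * X ^+ 5
  + (B ^+ 2 - B' * B'') * X ^+ 8.
Proof.
rewrite /Phi_Delta Phi_mod2 ?(@Phi_mod1 _ n.-1) ?Phi_mod0; try by rewrite /n; lia.
by rewrite /A /B /A' /B' /A'' /B'' /t; ring.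
Qed.

(** Here the square and the product both start at [X^2]. In units of [tri R m ^+ 2] their
    coefficients are [1/4] and [7m / (24 (m + 1))]. *)
Let lead : A ^+ 2 - A' * A'' = tri R m ^+ 2 * ((6 - m%:R) / (24 * (m%:R + 1))).
Proof.
have m1 : m%:R + 1 != 0 :> R by rewrite natr1 pnatr_eq0.
rewrite /A /A' /A'' /t (@tri_partE _ m) /n; last lia.
rewrite (@tri_partE _ m.+1 0); last lia.
(* For [m = 0] there is no [m.-1] to refer to, and [A'] vanishes since [2 * 2 > n - 1 = 1]. *)
rewrite triS -natr1; case: (posnP m) m1 => [->|m_gt0] m1.
  by rewrite /tri_part /=; field.
rewrite (@tri_partE _ m.-1); last lia.
have -> : tri R m = tri R m.-1 / (6 * m%:R) by rewrite -[in LHS](prednK m_gt0) triS prednK.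
have m0 : m%:R != 0 :> R by rewrite pnatr_eq0 -lt0n.
by field; rewrite m1 m0.
Qed.

Lemma Delta_mod2_pos : (m < 6)%N -> exists L, forall l, (L <= l)%N -> 0 < Delta l n.
Proof.
move=> m6; apply: (@Delta_pos n 2 (A ^+ 2 - A' * A'')
  (2 * A * B - A' * B'' - B' * A'') (B ^+ 2 - B' * B'') 0) => //; first by rewrite /n addnS.
  have m6' : m%:R < 6 :> R by rewrite (ltr_nat R m 6).
  rewrite lead mulr_gt0 ?exprn_gt0 ?tri_gt0 // divr_gt0 ?subr_gt0 //.
  by rewrite mulr_gt0 // natr1.
by move=> X; rewrite Phi_DeltaE; ring.
Qed.

Lemma Delta_mod2_neg : (6 < m)%N -> exists L, forall l, (L <= l)%N -> Delta l n < 0.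
Proof.
move=> m6; apply: (@Delta_neg n 2 (A ^+ 2 - A' * A'')
  (2 * A * B - A' * B'' - B' * A'') (B ^+ 2 - B' * B'') 0) => //; first by rewrite /n addnS.
  have m6' : 6 < m%:R :> R by rewrite (ltr_nat R 6 m).
  rewrite lead pmulr_rlt0 ?exprn_gt0 ?tri_gt0 // pmulr_llt0 ?subr_lt0 //.
  by rewrite invr_gt0 mulr_gt0 // natr1.
by move=> X; rewrite Phi_DeltaE; ring.
Qed.

(** The [X^2] coefficients cancel exactly, so the sign comes from [X^5], the largest exponent that
    [eventually_pos] admits. *)
Lemma Delta_20_neg : m = 6%N -> exists L, forall l, (L <= l)%N -> Delta l n < 0.
Proof.
move=> m6; have lead0 : A ^+ 2 - A' * A'' = 0 by rewrite lead m6 subrr mul0r mulr0.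
apply: (@Delta_neg n 5 (2 * A * B - A' * B'' - B' * A'') (B ^+ 2 - B' * B'') 0 0) => //.
- by rewrite /n addnS.
- rewrite /A /B /A' /B' /A'' /B'' /t /n m6 /=.
  rewrite (@tri_partE _ 6) // (@tri_partE _ 4) // (@tri_partE _ 5) //.
  rewrite (@tri_partE _ 5) // (@tri_partE _ 3) // (@tri_partE _ 7) //.
  (* Everything becomes a rational multiple of the square of [tri R 3], and the multiple is
     negative. *)
  rewrite !(@triS _ 6, @triS _ 5, @triS _ 4, @triS _ 3).
  have := tri_gt0 R 3; move: (tri R 3) => u u_gt0.
  have : 0 < u ^+ 2 by rewrite exprn_gt0.
  lra.
by move=> X; rewrite Phi_DeltaE lead0; ring.
Qed.
End Mod2.
End Sign.

(** The real algebraic numbers are Archimedean and real closed; [X^3 - 3] changes sign between 0 and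
    2. *)
Lemma realalg_cbrt3 : exists2 b : realalg, (0 < b)%R & (b ^+ 3 = 3)%R.
Proof.
pose p : {poly realalg} := ('X^3 - 3%:P)%R.
have pE x : (p.[x] = x ^+ 3 - 3)%R by rewrite !hornerE.
have [||b /andP[b_ge0 _] /rootP] := @poly_ivt _ p 0%R 2%R.
- by rewrite ler0n.
- by rewrite !pE; apply/andP; split; lra.
rewrite pE => /eqP; rewrite subr_eq0 => /eqP b3; exists b => //.
rewrite lt_def b_ge0 andbT; apply/eqP => b0.
by move: b3; rewrite b0 expr0n /= => /eqP; rewrite eq_sym pnatr_eq0.
Qed.

Theorem theorem1p2 (n : nat) (hn : (2 <= n)%N) :
  ((n %% 3 = 0)%N ->
     exists L : nat, forall l : nat, (0 < l)%N -> (L <= l)%N -> (0 <= Delta l n)%R) /\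
  ((n %% 3 = 1)%N ->
     exists L : nat, forall l : nat, (0 < l)%N -> (L <= l)%N -> (Delta l n < 0)%R) /\
  ((n %% 3 = 2)%N -> (n < 20)%N ->
     exists L : nat, forall l : nat, (0 < l)%N -> (L <= l)%N -> (0 <= Delta l n)%R) /\
  ((n %% 3 = 2)%N -> (20 <= n)%N ->
     exists L : nat, forall l : nat, (0 < l)%N -> (L <= l)%N -> (Delta l n < 0)%R).
Proof.
have [b b_gt0 b3] := realalg_cbrt3.
have nE : (n %% 3 = 2)%N -> n = (3 * (n %/ 3) + 2)%N by lia.
split=> [n0|]; [|split=> [n1|]; [|split=> n2 n20]].
(* The two [erefl] fix [q] and [r] as [2 / b^2] and [5 / b^5]. *)
- have [L HL] := Delta_mod0 b_gt0 b3 erefl erefl hn n0.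
  by exists L => l _ /HL/ltW.
- have [L HL] := Delta_mod1 b_gt0 b3 erefl erefl hn n1.
  by exists L => l _ /HL.
- have m6 : (n %/ 3 < 6)%N by lia.
  have [L HL] := Delta_mod2_pos b_gt0 b3 erefl erefl m6.
  by exists L => l _ /HL; rewrite -nE // => /ltW.
(* Now [n %/ 3] is at least 6, with equality exactly for [n = 20]. *)
- have [m6|m6] := eqVneq (n %/ 3)%N 6.
    have [L HL] := Delta_20_neg b_gt0 b3 erefl erefl m6.
    by exists L => l _ /HL; rewrite -nE.
  have m6' : (6 < n %/ 3)%N by lia.
  have [L HL] := Delta_mod2_neg b_gt0 b3 erefl erefl m6'.
  by exists L => l _ /HL; rewrite -nE.
Qed.
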